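(* If $a$ and $n$ are positive integers with $a<n$ and $p$ is a real number with $0<p<1$, then $$\binom{n}{a}p^a(1-p)^{n-a}<\frac{C}{\sqrt{np(1-p)}},$$ where $C=\left(\frac{3}{2e}\right)^{3/2}$.
   Context: $e$ denotes the base of the natural logarithm. *)

(* Defs.v *)
From Stdlib Require Export Reals.

(* Main.v *)
Require Import Defs.
From Stdlib Require Import Reals.
From Stdlib Require Import Factorial Lra Lia.
From Coquelicot Require Import Coquelicot.
Open Scope R_scope.

(** Put [b = n - a] and [phi x = x * ln x].  In logarithms, the left-hand side
    times [sqrt (n p (1 - p))] is largest at [p = (a + 1/2) / (n + 1)], where it
    equals [ln n! + ln n / 2 - phi (n + 1) + S a + S b] with
    [S k = phi (k + 1/2) - ln k!].  The sequence [S] is convex, so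
    [S a + S b <= S 1 + S (n - 1)]: the worst case is [a = 1], which stays below
    its limit [ln C] as [n] tends to infinity.  Both the convexity and the last bound
    follow from [ln y - ln x >= 2 (y - x) / (x + y)]. *)

Lemma nonneg_derive_le (f df : R -> R) (a b : R) :
  a <= b ->
  (forall x, a <= x <= b -> is_derive f x (df x)) ->
  (forall x, a <= x <= b -> 0 <= df x) ->
  f a <= f b.
Proof.
  intros hab hd hpos.
  destruct (MVT_gen f a b df) as [c [hc heq]];
    rewrite ?Rmin_left, ?Rmax_right in * by lra.
  - intros x hx; apply hd; lra.
  - intros x hx; apply continuity_pt_filterlim.
    apply (ex_derive_continuous f); exists (df x); apply hd; lra.
  - specialize (hpos c hc); nra.
Qed.

(** For fixed [x] the gap between the two sides vanishes at [y = x], and its derivative in [y] is a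
    square over a positive quantity. *)
Lemma ln_sub_ge (x y : R) :
  0 < x -> x <= y -> 2 * (y - x) / (x + y) <= ln y - ln x.
Proof.
  intros hx hxy.
  set (f := fun t => ln t - ln x - 2 * (t - x) / (x + t)).
  assert (h : f x <= f y).
  { apply nonneg_derive_le with (df := fun t => (t - x) ^ 2 / (t * (x + t) ^ 2)).
    - exact hxy.
    - intros t ht; unfold f; auto_derive; [lra | field; lra].
    - intros t ht; apply Rdiv_le_0_compat; [apply pow2_ge_0 |].
      apply Rmult_lt_0_compat; [| apply pow_lt]; lra. }
  unfold f in h.
  replace (2 * (x - x) / (x + x)) with 0 in h by (field; lra).
  lra.
Qed.

Definition phi (x : R) : R := x * ln x.

(** The derivative is nonnegative because [ln_sub_ge] between [t - / 2] and [t + / 2] gives exactly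
    [/ t]. At [t = k + 1] the function is the increment of [log_weight] from [k] to [k + 1]. *)
Lemma phi_second_difference_mono (x y : R) :
  / 2 < x -> x <= y ->
  phi (x + / 2) - phi (x - / 2) - ln x <= phi (y + / 2) - phi (y - / 2) - ln y.
Proof.
  intros hx hxy.
  apply nonneg_derive_le with
    (f := fun t => phi (t + / 2) - phi (t - / 2) - ln t)
    (df := fun t => ln (t + / 2) - ln (t - / 2) - / t).
  - exact hxy.
  - intros t ht; unfold phi; auto_derive; [repeat split; lra |].
    unfold Rminus; field; lra.
  - intros t ht.
    generalize (ln_sub_ge (t - / 2) (t + / 2) ltac:(lra) ltac:(lra)).
    replace (2 * (t + / 2 - (t - / 2)) / (t - / 2 + (t + / 2))) with (/ t)
      by (field; lra).
    lra.
Qed.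

Definition log_weight (k : nat) : R := phi (INR k + / 2) - ln (INR (fact k)).

Lemma ln_fact_S (k : nat) :
  ln (INR (fact (S k))) = ln (INR k + 1) + ln (INR (fact k)).
Proof.
  rewrite fact_simpl, mult_INR, S_INR, ln_mult; auto using INR_fact_lt_0.
  generalize (pos_INR k); lra.
Qed.

Lemma log_weight_S (k : nat) :
  log_weight (S k) - log_weight k =
  phi (INR k + 1 + / 2) - phi (INR k + 1 - / 2) - ln (INR k + 1).
Proof.
  unfold log_weight; rewrite ln_fact_S, S_INR.
  replace (INR k + 1 - / 2) with (INR k + / 2) by lra.
  lra.
Qed.

Lemma log_weight_convex (j k : nat) :
  (j <= k)%nat ->
  log_weight (S j) - log_weight j <= log_weight (S k) - log_weight k.
Proof.
  intros hjk; rewrite !log_weight_S.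
  apply phi_second_difference_mono.
  - generalize (pos_INR j); lra.
  - apply le_INR in hjk; lra.
Qed.

(** Raising [a] by one adds the increment at [S a] on the left and the one at [S (a + b)] on the
    right, which is at least as large by convexity. *)
Lemma log_weight_add_le (a b : nat) :
  log_weight (S a) + log_weight (S b) <= log_weight 1 + log_weight (S (a + b)).
Proof.
  induction a as [| a IH].
  - rewrite Nat.add_0_l; lra.
  - generalize (log_weight_convex (S a) (S (a + b)) ltac:(lia)).
    rewrite Nat.add_succ_l; lra.
Qed.

Lemma ln_le_sub_1 (x : R) : 0 < x -> ln x <= x - 1.
Proof.
  intros hx; generalize (exp_ineq1_le (ln x)); rewrite exp_ln by exact hx; lra.
Qed.

(** Gibbs' inequality, with equality at [p = u / (u + v)]: apply [ln z <= z - 1] to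
    [p * (u + v) / u] and to [(1 - p) * (u + v) / v]; the weighted upper bounds add up to zero. *)
Lemma weighted_ln_le (u v p : R) :
  0 < u -> 0 < v -> 0 < p -> p < 1 ->
  u * ln p + v * ln (1 - p) <= phi u + phi v - phi (u + v).
Proof.
  intros hu hv hp hp1; unfold phi.
  assert (key : forall w q, 0 < w -> 0 < q ->
            w * (ln q + ln (u + v) - ln w) <= q * (u + v) - w).
  { intros w q hw hq.
    replace (ln q + ln (u + v) - ln w) with (ln (q * (u + v) / w)).
    - assert (hpos : 0 < q * (u + v) / w)
        by (apply Rdiv_lt_0_compat; [apply Rmult_lt_0_compat |]; lra).
      apply Rle_trans with (w * (q * (u + v) / w - 1)).
      + apply Rmult_le_compat_l; [lra | now apply ln_le_sub_1].
      + right; field; lra.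
    - rewrite ln_div, ln_mult; try apply Rmult_lt_0_compat; lra. }
  generalize (key u p hu hp) (key v (1 - p) hv ltac:(lra)); lra.
Qed.

(** As [3 / 2 = (x + 1) - (x - / 2)], the left side is minus the sum of
    [(x - / 2) * (ln x - ln (x - / 2))] and [(x + 1) * (ln (x + 1) - ln x)]. *)
Lemma worst_case_lt (x : R) :
  1 <= x -> 3 / 2 * ln x + phi (x - / 2) - phi (x + 1) < - (3 / 2).
Proof.
  intros hx; unfold phi.
  assert (h1 := ln_sub_ge (x - / 2) x ltac:(lra) ltac:(lra)).
  assert (h2 := ln_sub_ge x (x + 1) ltac:(lra) ltac:(lra)).
  apply Rmult_le_compat_l with (r := x - / 2) in h1; [| lra].
  apply Rmult_le_compat_l with (r := x + 1) in h2; [| lra].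
  replace ((x - / 2) * (2 * (x - (x - / 2)) / (x - / 2 + x)))
    with (/ 2 - / (8 * x - 2)) in h1 by (field; lra).
  replace ((x + 1) * (2 * (x + 1 - x) / (x + (x + 1))))
    with (1 + / (2 * x + 1)) in h2 by (field; lra).
  assert (h3 : / (8 * x - 2) < / (2 * x + 1))
    by (apply Rinv_lt_contravar; [apply Rmult_lt_0_compat |]; lra).
  lra.
Qed.

Lemma ln_sqrt (x : R) : 0 < x -> ln (sqrt x) = / 2 * ln x.
Proof.
  intros hx; rewrite <- Rpower_sqrt by exact hx; apply ln_exp.
Qed.

Theorem lemma7 (a n : nat) (p : R)
    (ha : (0 < a)%nat) (han : (a < n)%nat) (hp0 : 0 < p) (hp1 : p < 1) :
  Binomial.C n a * p ^ a * (1 - p) ^ (n - a)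
    < Rpower (3 / (2 * exp 1)) (3 / 2) / sqrt (INR n * p * (1 - p)).
Proof.
  destruct a as [| a]; [lia |].
  (* Both [a] and [b] are now shifted down by one: the two positive parts of [n] are [S a] and
     [S b]. *)
  destruct (Nat.le_exists_sub (S (S a)) n han) as [b [hn _]].
  replace (n - S a)%nat with (S b) by lia.
  assert (hnS : n = S (S (a + b))) by lia.
  assert (hn1 : 1 <= INR n) by (apply (le_INR 1); lia).
  assert (hsum : INR (S a) + INR (S b) = INR n)
    by (rewrite <- plus_INR; f_equal; lia).
  assert (hprev : INR (S (a + b)) = INR n - 1) by (rewrite hnS, (S_INR (S _)); lra).
  (* The factorial left over cancels against the one in [log_weight (S (a + b))]; the split-off
     [ln n] joins the half from the square root to give the [3 / 2 * ln n] of [worst_case_lt]. *)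
  assert (hfact : ln (INR (fact n)) = ln (INR n) + ln (INR (fact (S (a + b))))).
  { rewrite hnS at 1; rewrite ln_fact_S, hprev; do 2 f_equal; lra. }
  assert (hq : 0 < 1 - p) by lra.
  assert (hpow : 0 < p ^ S a) by now apply pow_lt.
  assert (hqow : 0 < (1 - p) ^ S b) by now apply pow_lt.
  assert (hnp : 0 < INR n * p) by (apply Rmult_lt_0_compat; lra).
  assert (hnpq : 0 < INR n * p * (1 - p)) by now apply Rmult_lt_0_compat.
  assert (he := exp_pos 1).
  assert (hfab : 0 < INR (fact (S a)) * INR (fact (S b)))
    by (apply Rmult_lt_0_compat; apply INR_fact_lt_0).
  assert (hC : 0 < Binomial.C n (S a)).
  { unfold Binomial.C; replace (n - S a)%nat with (S b) by lia.
    apply Rdiv_lt_0_compat; [apply INR_fact_lt_0 | exact hfab]. }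
  assert (hCp : 0 < Binomial.C n (S a) * p ^ S a) by now apply Rmult_lt_0_compat.
  assert (hs : 0 < sqrt (INR n * p * (1 - p))) by now apply sqrt_lt_R0.
  assert (hR : 0 < Rpower (3 / (2 * exp 1)) (3 / 2)) by apply exp_pos.
  apply ln_lt_inv.
  - now apply Rmult_lt_0_compat.
  - now apply Rdiv_lt_0_compat.
  - rewrite ln_div, ln_sqrt, !ln_mult by (assumption || lra).
    unfold Rpower at 1; rewrite ln_exp.
    rewrite ln_div, ln_mult, ln_exp, !ln_pow by lra.
    unfold Binomial.C; replace (n - S a)%nat with (S b) by lia.
    rewrite ln_div, ln_mult by (apply INR_fact_lt_0 || exact hfab).
    (* The halves come from [sqrt (p * (1 - p))], moved to the left-hand side. *)
    assert (hmax := weighted_ln_le (INR (S a) + / 2) (INR (S b) + / 2) p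
      ltac:(generalize (pos_INR (S a)); lra)
      ltac:(generalize (pos_INR (S b)); lra) hp0 hp1).
    replace (INR (S a) + / 2 + (INR (S b) + / 2)) with (INR n + 1) in hmax by lra.
    assert (hconv := log_weight_add_le a b).
    unfold log_weight in hconv.
    rewrite hprev in hconv.
    replace (INR n - 1 + / 2) with (INR n - / 2) in hconv by lra.
    assert (hworst := worst_case_lt (INR n) hn1).
    (* This is the factor [(3 / 2) ^ (3 / 2)] of the constant; [hworst] supplies the power of [e]
       and the strictness. *)
    assert (h32 : phi (INR 1 + / 2) = 3 / 2 * (ln 3 - ln 2)).
    { unfold phi; simpl INR; rewrite <- ln_div by lra.
      replace (1 + / 2) with (3 / 2) by lra; reflexivity. }
    assert (h1 : ln (INR (fact 1)) = 0) by (simpl; apply ln_1).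
    rewrite h32, h1 in hconv.
    rewrite hfact.
    lra.
Qed.
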